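(* Let $0<q<1$, $0<\alpha<1$ and $z>0$, with $z(1-q)^{\alpha}<1$ (so that the series defining $e_{\alpha,1}(-z;q)$ is in its stated domain). Then $$\frac{1}{1+\Gamma_q(1-\alpha)\,z}\;\le\; e_{\alpha,1}(-z;q)\;\le\;\frac{1}{1+\Gamma_q(\alpha+1)^{-1}z}.$$ In particular, $$0<e_{\alpha,1}(-z;q)<1.$$
   Context: Fix $0<q<1$. For $a\in\mathbb{R}$, $(a;q)_\infty=\prod_{k=0}^\infty(1-q^k a)$. The $q$-Gamma function is, for $x>0$, $$\Gamma_q(x)=\frac{(q;q)_\infty}{(q^x;q)_\infty}(1-q)^{1-x}.$$ The $q$-Mittag-Leffler function is $$e_{\alpha,\beta}(z;q)=\sum_{k=0}^\infty\frac{z^k}{\Gamma_q(\alpha k+\beta)},\qquad |z(1-q)^\alpha|<1 .$$ *)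

(* Defs.v *)
From Stdlib Require Import Reals.
From Coquelicot Require Import Coquelicot.
Open Scope R_scope.

(* Stdlib with Coquelicot.  [Lim_seq] and [Series] are total: they denote the
   limit and the sum whenever these exist.  For 0 < q < 1 the infinite product
   converges for every real a. *)

Definition qPochhammer (a q : R) : R :=
  real (Lim_seq (fun n => prod_f_R0 (fun k => 1 - q ^ k * a) n)).

(* Meant for 0 < q < 1 and x > 0. *)
Definition qGamma (q x : R) : R :=
  qPochhammer q q / qPochhammer (Rpower q x) q * Rpower (1 - q) (1 - x).

(* Meant for |z (1-q)^alpha| < 1, where the series converges. *)
Definition qMittagLeffler (alpha beta z q : R) : R :=
  Series (fun k => z ^ k / qGamma q (alpha * INR k + beta)).

(* Main.v *)
Require Import Defs.
From Stdlib Require Import Reals Lra Lia.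
From Coquelicot Require Import Coquelicot.
Open Scope R_scope.

(** Put p = q^alpha and x = z (1-q)^alpha < 1.  In these variables
    e_{alpha,1}(-z;q) is E(x) = sum_k c_k (-x)^k with
    c_k = (q p^k;q)_oo / (q;q)_oo, and the proof studies E on the grid x p^n.

    The q-binomial theorem sum_j (a;q)_j/(q;q)_j y^j = (a y;q)_oo/(y;q)_oo at
    y = q p^k writes c_(k+1) / c_k (for a = p) and c_(k-1) / c_k (for a = 1/p) as
    series in p^k, and p^(jk) is the effect on the k-th coefficient of replacing
    x by x p^j.  Summing over k ([Series_qbin_mlAlt]) gives two equations, which
    are discrete forms of the integral and the differential equation of the
    Mittag-Leffler function:

      1 - E(x) = x * sum_{j>=0} b_j E(x p^j),
      (1 + x) E(x) = K + sum_{j>=1} d_j E(x p^j).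

    The weights b_j and d_j are nonnegative, sum b_j = (p q;q)_oo/(q;q)_oo
    = (1-q)^(-alpha) / Gamma_q(alpha+1), and sum d_j = 1 - K with
    K = (q/p;q)_oo/(q;q)_oo = (1-q)^alpha / Gamma_q(1-alpha) > 0.

    As the d_j add up to less than 1, the second equation obeys a minimum
    principle ([minimum_principle]).  Applied to E along the grid it gives E >= 0;
    applied to the increments of E it then gives E(x p) >= E(x).  Hence every
    grid value E(x p^j) can be replaced by its lower bound E(x): in the first
    equation this yields 1 - E(x) >= x E(x) sum b_j, which is the upper bound, and
    in the second (K + x) E(x) >= K, which is the lower bound. *)


(** * Series with two indices *)

Lemma Series_le_signed (a b : nat -> R) :
  ex_series a -> ex_series b -> (forall n, a n <= b n) -> Series a <= Series b.
Proof.
  intros Ha Hb Hab.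
  assert (H : 0 <= Series (fun n => b n - a n)).
  { rewrite <- (Rmult_0_l (Series (fun n => b n - a n))), <- Series_scal_l.
    apply Series_le.
    - intro n; specialize (Hab n); lra.
    - exact (ex_series_minus b a Hb Ha). }
  rewrite (Series_minus b a Hb Ha) in H; lra.
Qed.

Lemma ex_series_dominated (a b : nat -> R) :
  (forall n, Rabs (a n) <= b n) -> ex_series b -> ex_series a.
Proof. exact (ex_series_le (K := R_AbsRing) (V := R_CompleteNormedModule) a b). Qed.

Lemma Series_dominated (a b : nat -> R) :
  (forall n, Rabs (a n) <= b n) -> ex_series b -> Rabs (Series a) <= Series b.
Proof.
  intros Hab Hb.
  assert (Habs : ex_series (fun n => Rabs (a n))).
  { apply ex_series_dominated with b; [|assumption].
    intro n; rewrite Rabs_Rabsolu; apply Hab. }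
  eapply Rle_trans; [apply Series_Rabs, Habs|].
  apply Series_le_signed; assumption.
Qed.

Lemma is_lim_seq_Series_tail (a : nat -> R) :
  ex_series a -> is_lim_seq (fun n => Series (fun k => a (n + k)%nat)) 0.
Proof.
  intro Ha.
  apply is_lim_seq_incr_1.
  apply is_lim_seq_ext with (fun n => Series a - sum_n a n).
  - intro n.
    rewrite (Series_incr_n a (S n)), sum_n_Reals by (lia || assumption); simpl; ring.
  - replace (Finite 0) with (Finite (Series a - Series a)) by (f_equal; ring).
    apply is_lim_seq_minus'; [apply is_lim_seq_const|].
    exact (Series_correct a Ha).
Qed.

(** Splitting off the first [n] rows leaves a double series over the rows from
    [n] on, and domination makes that remainder at most a tail of [A] times the
    sum of [B]. *)
Lemma Series_swap (f : nat -> nat -> R) (A B : nat -> R) :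
  (forall j k, Rabs (f j k) <= A j * B k) -> ex_series A -> ex_series B ->
  Series (fun j => Series (f j)) = Series (fun k => Series (fun j => f j k)).
Proof.
  intros Hf HA HB.
  assert (HAn : forall n, ex_series (fun j => A (n + j)%nat))
    by (intro n; apply (ex_series_incr_n A n), HA).
  assert (Hcol : forall n k, ex_series (fun j => f (n + j)%nat k)).
  { intros n k; apply ex_series_dominated with (fun j => A (n + j)%nat * B k).
    - intro j; apply Hf.
    - apply ex_series_scal_r, HAn. }
  assert (Hrow : forall j, ex_series (f j)).
  { intro j; apply ex_series_dominated with (fun k => A j * B k).
    - apply Hf.
    - exact (ex_series_scal (A j) B HB). }
  assert (HT : forall n k, Rabs (Series (fun j => f (n + j)%nat k))
                           <= Series (fun j => A (n + j)%nat) * B k).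
  { intros n k; rewrite <- Series_scal_r; apply Series_dominated.
    - intro j; apply Hf.
    - apply ex_series_scal_r, HAn. }
  assert (HexT : forall n, ex_series (fun k => Series (fun j => f (n + j)%nat k))).
  { intro n; eapply ex_series_dominated; [exact (HT n)|].
    exact (ex_series_scal _ B HB). }
  assert (Hsplit : forall n, Series (fun k => Series (fun j => f j k))
            = sum_f_R0 (fun j => Series (f j)) n
              + Series (fun k => Series (fun j => f (S n + j)%nat k))).
  { assert (Hstep : forall n, Series (fun k => Series (fun j => f (n + j)%nat k))
       = Series (f n) + Series (fun k => Series (fun j => f (S n + j)%nat k))).
    { intro n; rewrite <- Series_plus by (apply Hrow || apply HexT).
      apply Series_ext; intro k.
      rewrite (Series_incr_1 (fun j => f (n + j)%nat k)) by apply Hcol.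
      rewrite Nat.add_0_r; f_equal.
      apply Series_ext; intro j; f_equal; lia. }
    induction n as [|n IH].
    - exact (Hstep 0%nat).
    - rewrite IH, Hstep; simpl; ring. }
  apply is_series_unique.
  set (S2 := Series (fun k => Series (fun j => f j k))) in *.
  change (is_lim_seq (sum_n (fun j => Series (f j))) S2).
  apply is_lim_seq_ext
    with (fun n => S2 - Series (fun k => Series (fun j => f (S n + j)%nat k))).
  { intro n; rewrite sum_n_Reals, (Hsplit n); ring. }
  replace (Finite S2) with (Finite (S2 - 0)) by (f_equal; ring).
  apply is_lim_seq_minus'; [apply is_lim_seq_const|].
  apply is_lim_seq_incr_1
    with (u := fun n => Series (fun k => Series (fun j => f (n + j)%nat k))).
  apply is_lim_seq_abs_0.
  apply is_lim_seq_le_le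
    with (fun _ => 0) (fun n => Series (fun j => A (n + j)%nat) * Series B).
  - intro n; split; [apply Rabs_pos|].
    rewrite <- Series_scal_l; apply Series_dominated; [exact (HT n)|].
    exact (ex_series_scal _ B HB).
  - apply is_lim_seq_const.
  - replace (Finite 0) with (Finite (0 * Series B)) by (f_equal; ring).
    apply is_lim_seq_mult'; [apply is_lim_seq_Series_tail, HA|apply is_lim_seq_const].
Qed.

(** * Infinite products and the q-binomial theorem *)

Lemma pow_le_1 (p : R) (k : nat) : 0 < p < 1 -> 0 < p ^ k <= 1.
Proof.
  intro Hp; split; [apply pow_lt; lra|].
  rewrite <- (pow1 k); apply pow_incr; lra.
Qed.

Lemma mul_pow_lt_1 (x p : R) (k : nat) : 0 < p < 1 -> 0 <= x < 1 ->
  0 <= x * p ^ k < 1.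
Proof. intros Hp Hx; destruct (pow_le_1 p k Hp); split; nra. Qed.

Lemma qprod_bounds (x q : R) (n : nat) : 0 < q < 1 -> 0 <= x < 1 ->
  0 < prod_f_R0 (fun k => 1 - q ^ k * x) n <= 1.
Proof.
  intros Hq Hx.
  assert (Hk : forall k, 0 < 1 - q ^ k * x <= 1).
  { intro k; assert (H := pow_le_1 q k Hq); split; nra. }
  induction n as [|n IH]; cbn [prod_f_R0]; [apply Hk|].
  specialize (Hk (S n)); split; nra.
Qed.

Lemma is_lim_seq_qPochhammer (x q : R) : 0 < q < 1 -> 0 <= x < 1 ->
  is_lim_seq (fun n => prod_f_R0 (fun k => 1 - q ^ k * x) n) (qPochhammer x q).
Proof.
  intros Hq Hx; apply Lim_seq_correct', ex_finite_lim_seq_decr with 0.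
  - intro n; cbn [prod_f_R0].
    destruct (qprod_bounds x q n Hq Hx).
    assert (0 < q ^ S n) by (apply pow_lt; lra).
    assert (0 <= q ^ S n * x) by (apply Rmult_le_pos; lra); nra.
  - intro n; destruct (qprod_bounds x q n Hq Hx); lra.
Qed.

Lemma qPochhammer_le_1 (x q : R) : 0 < q < 1 -> 0 <= x < 1 ->
  0 <= qPochhammer x q <= 1.
Proof.
  intros Hq Hx; assert (H := is_lim_seq_qPochhammer x q Hq Hx); split.
  - apply (is_lim_seq_le (fun _ => 0) _ 0 _
             (fun n => Rlt_le _ _ (proj1 (qprod_bounds x q n Hq Hx)))
             (is_lim_seq_const 0) H).
  - apply (is_lim_seq_le _ (fun _ => 1) _ 1
             (fun n => proj2 (qprod_bounds x q n Hq Hx)) H (is_lim_seq_const 1)).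
Qed.

(** The coefficient (a;q)_j / (q;q)_j. *)
Fixpoint qbin (a q : R) (j : nat) : R :=
  match j with
  | O => 1
  | S j => qbin a q j * ((1 - a * q ^ j) / (1 - q ^ S j))
  end.

Lemma pow_S_lt_1 (q : R) (j : nat) : 0 < q < 1 -> 0 < q ^ S j < 1.
Proof.
  intro Hq; split; [apply pow_lt; lra|].
  apply pow_lt_1_compat; [lra|lia].
Qed.

Lemma qbin_neq_0 (a q : R) (j : nat) : 0 < q < 1 ->
  (forall j, a * q ^ j <> 1) -> qbin a q j <> 0.
Proof.
  intros Hq Ha; induction j as [|j IH]; [exact R1_neq_R0|].
  cbn [qbin]; assert (H := pow_S_lt_1 q j Hq).
  apply Rmult_integral_contrapositive; split; [exact IH|].
  specialize (Ha j); unfold Rdiv; apply Rmult_integral_contrapositive.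
  split; [lra|apply Rinv_neq_0_compat; lra].
Qed.

Lemma CV_radius_qbin (a q : R) : 0 < q < 1 ->
  (forall j, a * q ^ j <> 1) -> CV_radius (qbin a q) = 1.
Proof.
  intros Hq Ha; replace (Finite 1) with (Finite (/ 1)) by (f_equal; field).
  apply CV_radius_finite_DAlembert; [intro; apply qbin_neq_0; assumption|lra|].
  assert (Hgeom : is_lim_seq (fun n => q ^ n) 0)
    by (apply is_lim_seq_geom; rewrite Rabs_pos_eq; lra).
  apply is_lim_seq_ext with (fun n => Rabs ((1 - a * q ^ n) / (1 - q ^ S n))).
  { intro n; f_equal; cbn [qbin]; field; split.
    - assert (H := pow_S_lt_1 q n Hq); simpl in H |- *; lra.
    - apply qbin_neq_0; assumption. }
  replace (Finite 1) with (Rbar_abs ((1 - a * 0) / (1 - 0)))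
    by (simpl; f_equal; rewrite Rabs_pos_eq; lra).
  apply is_lim_seq_abs, is_lim_seq_div'; [| |lra];
    (apply is_lim_seq_minus'; [apply is_lim_seq_const|]).
  - apply is_lim_seq_mult'; [apply is_lim_seq_const|exact Hgeom].
  - apply is_lim_seq_incr_1 in Hgeom; exact Hgeom.
Qed.

Lemma ex_series_Rabs_qbin (a q x : R) : 0 < q < 1 ->
  (forall j, a * q ^ j <> 1) -> 0 <= x < 1 ->
  ex_series (fun j => Rabs (qbin a q j * x ^ j)).
Proof.
  intros Hq Ha Hx; apply CV_disk_inside; rewrite CV_radius_qbin by assumption.
  simpl; rewrite Rabs_pos_eq; lra.
Qed.

(** The recurrence between consecutive coefficients, read on generating functions. *)
Lemma qbin_functional_equation (a q x : R) : 0 < q < 1 ->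
  (forall j, a * q ^ j <> 1) -> 0 <= x < 1 ->
  (1 - x) * PSeries (qbin a q) x = (1 - a * x) * PSeries (qbin a q) (q * x).
Proof.
  intros Hq Ha Hx.
  assert (Hex : forall y, 0 <= y < 1 -> ex_series (fun j => qbin a q j * y ^ j))
    by (intros; apply ex_series_Rabs, ex_series_Rabs_qbin; assumption).
  assert (Hqx : 0 <= q * x < 1) by nra.
  enough (H : PSeries (qbin a q) x - PSeries (qbin a q) (q * x)
              = x * PSeries (qbin a q) x - a * x * PSeries (qbin a q) (q * x)) by lra.
  unfold PSeries; rewrite <- !Series_scal_l, <- !Series_minus;
    try (apply Hex; assumption);
    try (apply (ex_series_scal (K := R_AbsRing) (V := R_NormedModule)), Hex; assumption).
  rewrite Series_incr_1.
  2: { exact (ex_series_minus _ _ (Hex x Hx) (Hex _ Hqx)). }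
  simpl pow; rewrite !Rmult_1_r, Rminus_diag, Rplus_0_l.
  apply Series_ext; intro j; cbn [qbin]; rewrite !Rpow_mult_distr.
  assert (H := pow_S_lt_1 q j Hq); simpl in H |- *; field; lra.
Qed.

(** Iterating the functional equation [n] times exhibits both products, and the
    remaining factor, the value at [q ^ n * x], tends to the value 1 at 0. *)
Theorem q_binomial (a q x : R) : 0 < q < 1 ->
  (forall j, a * q ^ j <> 1) -> 0 <= x < 1 -> 0 <= a * x < 1 ->
  qPochhammer x q * PSeries (qbin a q) x = qPochhammer (a * x) q.
Proof.
  intros Hq Ha Hx Hax.
  assert (Hiter : forall n,
    prod_f_R0 (fun k => 1 - q ^ k * x) n * PSeries (qbin a q) x
    = prod_f_R0 (fun k => 1 - q ^ k * (a * x)) n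
      * PSeries (qbin a q) (q ^ S n * x)).
  { assert (Hstep : forall n, (1 - q ^ n * x) * PSeries (qbin a q) (q ^ n * x)
       = (1 - q ^ n * (a * x)) * PSeries (qbin a q) (q ^ S n * x)).
    { intro n; assert (0 <= q ^ n * x < 1)
        by (rewrite Rmult_comm; apply mul_pow_lt_1; assumption).
      rewrite qbin_functional_equation by assumption; simpl.
      f_equal; [ring|f_equal; ring]. }
    induction n as [|n IH]; cbn [prod_f_R0].
    - rewrite <- Hstep; simpl; rewrite Rmult_1_l; reflexivity.
    - rewrite (Rmult_comm _ (1 - q ^ S n * x)), Rmult_assoc, IH.
      rewrite <- Rmult_assoc, (Rmult_comm _ (prod_f_R0 _ _)), !Rmult_assoc.
      f_equal; apply Hstep. }
  assert (Hl : is_lim_seq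
    (fun n => prod_f_R0 (fun k => 1 - q ^ k * x) n * PSeries (qbin a q) x)
    (qPochhammer x q * PSeries (qbin a q) x)).
  { apply is_lim_seq_mult'; [apply is_lim_seq_qPochhammer; assumption|].
    apply is_lim_seq_const. }
  assert (Hr : is_lim_seq
    (fun n => prod_f_R0 (fun k => 1 - q ^ k * x) n * PSeries (qbin a q) x)
    (qPochhammer (a * x) q * PSeries (qbin a q) 0)).
  { eapply is_lim_seq_ext; [intro n; symmetry; apply Hiter|].
    apply is_lim_seq_mult'; [apply is_lim_seq_qPochhammer; assumption|].
    apply is_lim_seq_continuous with (u := fun n => q ^ S n * x).
    - apply PSeries_continuity; rewrite CV_radius_qbin by assumption.
      simpl; rewrite Rabs_R0; lra.
    - replace (Finite 0) with (Finite (0 * x)) by (f_equal; ring).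
      apply is_lim_seq_mult'; [|apply is_lim_seq_const].
      assert (Hg : is_lim_seq (fun n => q ^ n) 0)
        by (apply is_lim_seq_geom; rewrite Rabs_pos_eq; lra).
      apply is_lim_seq_incr_1 in Hg; exact Hg. }
  apply is_lim_seq_unique in Hl; apply is_lim_seq_unique in Hr.
  rewrite Hl in Hr; injection Hr as Hr.
  rewrite Hr, PSeries_0; simpl; ring.
Qed.

(** The case a = 0 of the q-binomial theorem provides an inverse of the product. *)
Lemma qPochhammer_pos (x q : R) : 0 < q < 1 -> 0 <= x < 1 -> 0 < qPochhammer x q.
Proof.
  intros Hq Hx.
  assert (H1 : qPochhammer 0 q = 1).
  { assert (H := is_lim_seq_qPochhammer 0 q Hq ltac:(lra)).
    apply is_lim_seq_unique in H.
    rewrite (Lim_seq_ext _ (fun _ => 1)), Lim_seq_const in H.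
    - injection H as H; lra.
    - induction n as [|n IH]; cbn [prod_f_R0]; [|rewrite IH]; ring. }
  assert (H := q_binomial 0 q x Hq ltac:(intro; lra) Hx ltac:(lra)).
  rewrite Rmult_0_l, H1 in H.
  destruct (qPochhammer_le_1 x q Hq Hx) as [[Hlt|Heq] _]; [exact Hlt|].
  rewrite <- Heq in H; lra.
Qed.

(** * The Mittag-Leffler function on a geometric grid *)

(** With p = q^alpha this is (1-q)^(- alpha k) / Gamma_q(alpha k + 1), so the
    series below is the q-Mittag-Leffler function in the rescaled variable
    x = z (1-q)^alpha, whose domain of convergence is |x| < 1. *)
Definition mlCoef (p q : R) (k : nat) : R :=
  qPochhammer (q * p ^ k) q / qPochhammer q q.

Definition mlAlt (p q x : R) : R := PSeries (mlCoef p q) (- x).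

Lemma mlCoef_bounds (p q : R) (k : nat) : 0 < q < 1 -> 0 < p < 1 ->
  0 < mlCoef p q k <= / qPochhammer q q.
Proof.
  intros Hq Hp.
  assert (Hx : 0 <= q * p ^ k < 1) by (apply mul_pow_lt_1; lra).
  assert (0 < / qPochhammer q q)
    by (apply Rinv_0_lt_compat, qPochhammer_pos; lra).
  assert (H1 := qPochhammer_pos _ q Hq Hx).
  assert (H2 := qPochhammer_le_1 _ q Hq Hx).
  unfold mlCoef, Rdiv; split; nra.
Qed.

Lemma mlCoef_0 (p q : R) : 0 < q < 1 -> mlCoef p q 0 = 1.
Proof.
  intro Hq; unfold mlCoef; simpl; rewrite Rmult_1_r.
  assert (H := qPochhammer_pos q q Hq ltac:(lra)); field; lra.
Qed.

Lemma mlAlt_term_le (p q x : R) (k : nat) : 0 < q < 1 -> 0 < p < 1 -> 0 <= x < 1 ->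
  Rabs (mlCoef p q k * (- x) ^ k) <= / qPochhammer q q * x ^ k.
Proof.
  intros Hq Hp Hx; rewrite Rabs_mult, <- RPow_abs, Rabs_Ropp.
  destruct (mlCoef_bounds p q k Hq Hp).
  rewrite !Rabs_pos_eq by lra.
  apply Rmult_le_compat_r; [apply pow_le|]; lra.
Qed.

Lemma ex_series_majorant (C x : R) : 0 <= x < 1 -> ex_series (fun k => C * x ^ k).
Proof.
  intro Hx; apply (ex_series_scal (K := R_AbsRing) (V := R_NormedModule)).
  apply ex_series_geom; rewrite Rabs_pos_eq; lra.
Qed.

Lemma ex_pseries_mlCoef (p q x : R) : 0 < q < 1 -> 0 < p < 1 -> 0 <= x < 1 ->
  ex_series (fun k => mlCoef p q k * (- x) ^ k).
Proof.
  intros Hq Hp Hx; apply ex_series_dominated with (fun k => / qPochhammer q q * x ^ k).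
  - intro k; apply mlAlt_term_le; assumption.
  - apply ex_series_majorant; assumption.
Qed.

Lemma mlAlt_scaled_bounded (p q x : R) (n : nat) :
  0 < q < 1 -> 0 < p < 1 -> 0 <= x < 1 ->
  Rabs (mlAlt p q (x * p ^ n)) <= Series (fun k => / qPochhammer q q * x ^ k).
Proof.
  intros Hq Hp Hx; apply Series_dominated.
  - intro k; eapply Rle_trans.
    + apply mlAlt_term_le; [assumption|assumption|apply mul_pow_lt_1; assumption].
    + apply Rmult_le_compat_l.
      * apply Rlt_le, Rinv_0_lt_compat, qPochhammer_pos; lra.
      * destruct (pow_le_1 p n Hp); apply pow_incr; split; nra.
  - apply ex_series_majorant; assumption.
Qed.

(** The engine of the proof: a weighted sum over the grid x, x p, x p^2, ...
    acts on the k-th coefficient as the multiplier sum_j (a;q)_j/(q;q)_j (q p^k)^j,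
    which the q-binomial theorem evaluates.  For a = p and a = 1/p it shifts the
    index k by one, up and down respectively: these are the q-analogues of the
    fractional integral and the fractional derivative of order alpha. *)
Lemma Series_qbin_mlAlt (a p q x : R) : 0 < q < 1 -> 0 < p < 1 ->
  (forall j, a * q ^ j <> 1) -> 0 <= a * q < 1 -> 0 <= x < 1 ->
  Series (fun j => qbin a q j * q ^ j * mlAlt p q (x * p ^ j))
  = Series (fun k => qPochhammer (a * q * p ^ k) q / qPochhammer q q * (- x) ^ k).
Proof.
  intros Hq Hp Ha Haq Hx.
  assert (HC : 0 < / qPochhammer q q)
    by (apply Rinv_0_lt_compat, qPochhammer_pos; lra).
  transitivity (Series (fun j => Series (fun k =>
    qbin a q j * q ^ j * (mlCoef p q k * (- (x * p ^ j)) ^ k)))).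
  { apply Series_ext; intro j; symmetry; apply Series_scal_l. }
  rewrite Series_swap
    with (A := fun j => Rabs (qbin a q j * q ^ j))
         (B := fun k => / qPochhammer q q * x ^ k).
  - apply Series_ext; intro k.
    assert (Hqk : 0 <= q * p ^ k < 1) by (apply mul_pow_lt_1; lra).
    assert (Hk : 0 < qPochhammer (q * p ^ k) q) by (apply qPochhammer_pos; assumption).
    transitivity (mlCoef p q k * (- x) ^ k * PSeries (qbin a q) (q * p ^ k)).
    + unfold PSeries; rewrite <- Series_scal_l; apply Series_ext; intro j.
      replace (- (x * p ^ j)) with (- x * p ^ j) by ring.
      rewrite !Rpow_mult_distr, <- !pow_mult, (Nat.mul_comm k j); ring.
    + assert (Haqk : 0 <= a * (q * p ^ k) < 1)
        by (rewrite <- Rmult_assoc; apply mul_pow_lt_1; assumption).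
      rewrite (Rmult_assoc a q), <- (q_binomial a q (q * p ^ k) Hq Ha Hqk Haqk).
      unfold mlCoef, Rdiv; ring.
  - intros j k; rewrite Rabs_mult; apply Rmult_le_compat_l; [apply Rabs_pos|].
    eapply Rle_trans.
    + apply mlAlt_term_le; [assumption|assumption|apply mul_pow_lt_1; assumption].
    + apply Rmult_le_compat_l; [lra|].
      destruct (pow_le_1 p j Hp); apply pow_incr; split; nra.
  - apply ex_series_Rabs_qbin; [assumption|assumption|lra].
  - apply ex_series_majorant; assumption.
Qed.

(** The case a = p of the multiplier identity: shifting the coefficients up by one
    turns the series into itself divided by -x, up to the constant term.  This is
    the q-analogue of s + z I^alpha s = 1. *)
Lemma mlAlt_integral_equation (p q x : R) : 0 < q < 1 -> 0 < p < 1 -> 0 <= x < 1 ->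
  x * Series (fun j => qbin p q j * q ^ j * mlAlt p q (x * p ^ j)) = 1 - mlAlt p q x.
Proof.
  intros Hq Hp Hx.
  rewrite Series_qbin_mlAlt; try assumption.
  - unfold mlAlt, PSeries.
    rewrite (Series_incr_1 (fun k => mlCoef p q k * (- x) ^ k))
      by (apply ex_pseries_mlCoef; assumption).
    rewrite mlCoef_0 by assumption.
    replace (Series (fun k => mlCoef p q (S k) * (- x) ^ S k))
      with (- x * Series (fun k => qPochhammer (p * q * p ^ k) q / qPochhammer q q
                                   * (- x) ^ k)); [simpl; ring|].
    rewrite <- Series_scal_l; apply Series_ext; intro k; unfold mlCoef.
    replace (q * p ^ S k) with (p * q * p ^ k) by (simpl; ring); simpl; ring.
  - intros j Hj; destruct (pow_le_1 q j Hq); nra.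
  - split; nra.
Qed.

(** The weights of the q-fractional derivative of order alpha off the diagonal, with
    the sign changed to make them nonnegative. *)
Definition dweight (p q : R) (j : nat) : R := - (qbin (/ p) q (S j) * q ^ S j).

Lemma inv_mul_bounds (p q : R) : 0 < q < p -> 0 < / p * q < 1.
Proof.
  intro H; assert (0 < / p) by (apply Rinv_0_lt_compat; lra).
  split; [nra|]; apply Rmult_lt_reg_l with p; [lra|].
  rewrite <- Rmult_assoc, Rinv_r by lra; lra.
Qed.

(** The hypothesis [q < p], that is alpha < 1, keeps the sequence / p * q ^ j from
    meeting 1: it is above 1 for j = 0 only. *)
Lemma inv_mul_pow_neq_1 (p q : R) (j : nat) : 0 < q < p -> p < 1 ->
  / p * q ^ j <> 1.
Proof.
  intros H Hp; assert (1 < / p) by (rewrite <- Rinv_1; apply Rinv_lt_contravar; lra).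
  destruct j as [|j]; simpl; [lra|].
  assert (0 < q ^ j <= 1) by (apply pow_le_1; lra).
  assert (Hpq1 := inv_mul_bounds p q H); nra.
Qed.

(** Only the first factor of (1/p;q)_(j+1) is negative. *)
Lemma dweight_pos (p q : R) (j : nat) : 0 < q < p -> p < 1 -> 0 <= dweight p q j.
Proof.
  intros H Hp; assert (1 < / p) by (rewrite <- Rinv_1; apply Rinv_lt_contravar; lra).
  assert (Hpq1 := inv_mul_bounds p q H).
  assert (Hneg : qbin (/ p) q (S j) <= 0).
  { induction j as [|j IH].
    - assert (Hd : 0 < / (1 - q)) by (apply Rinv_0_lt_compat; lra).
      simpl; rewrite !Rmult_1_r, Rmult_1_l; unfold Rdiv; nra.
    - change (qbin (/ p) q (S j) * ((1 - / p * q ^ S j) / (1 - q ^ S (S j))) <= 0).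
      assert (Hs := pow_S_lt_1 q (S j) ltac:(lra)).
      assert (0 < q ^ j <= 1) by (apply pow_le_1; lra).
      assert (Hf : 0 <= (1 - / p * q ^ S j) / (1 - q ^ S (S j))).
      { apply Rdiv_le_0_compat; [simpl; nra|lra]. }
      nra. }
  assert (0 < q ^ S j) by (apply pow_lt; lra); unfold dweight; nra.
Qed.

Lemma ex_series_dweight (p q : R) : 0 < q < p -> p < 1 -> ex_series (dweight p q).
Proof.
  intros H Hp.
  apply ex_series_ext
    with (fun j => opp (qbin (/ p) q (S j) * q ^ S j)); [reflexivity|].
  apply (ex_series_opp (fun j => qbin (/ p) q (S j) * q ^ S j)).
  apply (ex_series_incr_1 (fun j => qbin (/ p) q j * q ^ j)).
  apply ex_series_Rabs, ex_series_Rabs_qbin; try lra.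
  intro j; apply inv_mul_pow_neq_1; assumption.
Qed.

Lemma Series_dweight (p q : R) : 0 < q < p -> p < 1 ->
  Series (dweight p q) = 1 - qPochhammer (/ p * q) q / qPochhammer q q.
Proof.
  intros H Hp; assert (Hpq1 := inv_mul_bounds p q H).
  assert (Hne : forall j, / p * q ^ j <> 1)
    by (intro; apply inv_mul_pow_neq_1; assumption).
  assert (Hpos : 0 < qPochhammer q q) by (apply qPochhammer_pos; lra).
  rewrite <- (q_binomial (/ p) q q) by (assumption || lra).
  unfold PSeries; rewrite (Series_incr_1 (fun j => qbin (/ p) q j * q ^ j))
    by (apply ex_series_Rabs, ex_series_Rabs_qbin; assumption || lra).
  unfold dweight; rewrite Series_opp; simpl; field; lra.
Qed.

(** The case a = 1/p of the multiplier identity, the q-analogue of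
    D^alpha (s - 1) = - z s.  The diagonal term is put on the left, so that the value
    at [x] is a combination with nonnegative weights of the values further down
    the grid. *)
Lemma mlAlt_differential_equation (p q x : R) : 0 < q < p -> p < 1 -> 0 <= x < 1 ->
  (1 + x) * mlAlt p q x
  = qPochhammer (/ p * q) q / qPochhammer q q
    + Series (fun j => dweight p q j * mlAlt p q (x * p ^ S j)).
Proof.
  intros H Hp Hx; assert (Hpq1 := inv_mul_bounds p q H).
  assert (Hne : forall j, / p * q ^ j <> 1)
    by (intro; apply inv_mul_pow_neq_1; assumption).
  assert (Hq : 0 < q < 1) by lra; assert (Hp' : 0 < p < 1) by lra.
  assert (E := Series_qbin_mlAlt (/ p) p q x Hq Hp' Hne ltac:(lra) Hx).
  assert (Hshift : forall k, qPochhammer (/ p * q * p ^ S k) q / qPochhammer q q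
                             = mlCoef p q k).
  { intro k; unfold mlCoef; do 2 f_equal; simpl; field; lra. }
  rewrite (Series_incr_1 (fun j => qbin (/ p) q j * q ^ j * _)) in E.
  - rewrite (Series_incr_1 (fun k => _ / qPochhammer q q * _)) in E.
    + rewrite (Series_ext
        (fun k => qPochhammer (/ p * q * p ^ S k) q / qPochhammer q q * (- x) ^ S k)
        (fun k => - x * (mlCoef p q k * (- x) ^ k))) in E
        by (intro k; rewrite Hshift; simpl; ring).
      rewrite Series_scal_l in E.
      change (Series (fun k => mlCoef p q k * (- x) ^ k)) with (mlAlt p q x) in E.
      rewrite (Series_ext (fun j => dweight p q j * mlAlt p q (x * p ^ S j))
        (fun j => - (qbin (/ p) q (S j) * q ^ S j * mlAlt p q (x * p ^ S j))))
        by (intro j; unfold dweight; ring).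
      rewrite Series_opp; cbn [pow qbin] in E |- *.
      rewrite !Rmult_1_r in E; lra.
    + apply ex_series_incr_1.
      apply ex_series_ext with (fun k => - x * (mlCoef p q k * (- x) ^ k)).
      * intro k; rewrite Hshift; simpl; ring.
      * apply (ex_series_scal (K := R_AbsRing) (V := R_NormedModule)).
        apply ex_pseries_mlCoef; assumption.
  - apply ex_series_dominated with (fun j => Rabs (qbin (/ p) q j * q ^ j)
      * Series (fun k => / qPochhammer q q * x ^ k)).
    + intro j; rewrite Rabs_mult; apply Rmult_le_compat_l; [apply Rabs_pos|].
      apply mlAlt_scaled_bounded; assumption.
    + apply ex_series_scal_r, ex_series_Rabs_qbin; assumption || lra.
Qed.

(** * Positivity and monotonicity along the grid *)

(** If v >= - m everywhere then the hypothesis gives v >= - r m everywhere, where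
    r < 1 is the total weight; a bounded sequence is therefore nonnegative. *)
Lemma minimum_principle (e v lam : nat -> R) (M : R) :
  (forall j, 0 <= e j) -> ex_series e -> Series e < 1 ->
  (forall n, 1 <= lam n) -> (forall n, Rabs (v n) <= M) ->
  (forall n, Series (fun j => e j * v (n + S j)%nat) <= lam n * v n) ->
  forall n, 0 <= v n.
Proof.
  intros He Hex Hlt Hlam HM Hrec.
  assert (Hexv : forall n, ex_series (fun j => e j * v (n + S j)%nat)).
  { intro n; apply ex_series_dominated with (fun j => e j * M).
    - intro j; rewrite Rabs_mult, (Rabs_pos_eq (e j)) by apply He.
      apply Rmult_le_compat_l; [apply He|apply HM].
    - apply ex_series_scal_r, Hex. }
  assert (HM0 : 0 <= M) by (eapply Rle_trans; [apply Rabs_pos|apply (HM 0%nat)]).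
  assert (Hr : 0 <= Series e).
  { replace 0 with (Series (fun _ => 0 * 0)) by (rewrite Series_scal_l; ring).
    apply Series_le; [|exact Hex].
    intro n; rewrite Rmult_0_l; split; [lra|apply He]. }
  assert (Hi : forall i n, - (Series e ^ i * M) <= v n).
  { induction i as [|i IH]; intro n.
    - specialize (HM n); apply Rabs_le_between in HM; simpl; lra.
    - assert (Hle : Series e * - (Series e ^ i * M) <= lam n * v n).
      { eapply Rle_trans; [|apply Hrec].
        rewrite <- Series_scal_r; apply Series_le_signed.
        - apply ex_series_scal_r, Hex.
        - apply Hexv.
        - intro j; apply Rmult_le_compat_l; [apply He|apply IH]. }
      assert (0 <= Series e ^ S i * M)
        by (apply Rmult_le_pos; [apply pow_le|]; assumption).
      specialize (Hlam n); simpl in *.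
      destruct (Rle_lt_dec 0 (v n)); nra. }
  intro n.
  change (Rbar_le 0 (v n)).
  apply is_lim_seq_le with (fun i => - (Series e ^ i * M)) (fun _ => v n).
  - intro i; apply Hi.
  - replace (Finite 0) with (Finite (- (0 * M))) by (f_equal; ring).
    apply is_lim_seq_opp with (u := fun i => Series e ^ i * M) (l := Finite (0 * M)).
    apply is_lim_seq_mult'; [|apply is_lim_seq_const].
    apply is_lim_seq_geom; rewrite Rabs_pos_eq; assumption.
  - apply is_lim_seq_const.
Qed.

Lemma ex_series_dweight_mlAlt (p q x : R) (n : nat) : 0 < q < p -> p < 1 ->
  0 <= x < 1 -> ex_series (fun j => dweight p q j * mlAlt p q (x * p ^ (n + S j))).
Proof.
  intros H Hp Hx.
  apply ex_series_dominated
    with (fun j => dweight p q j * Series (fun k => / qPochhammer q q * x ^ k)).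
  - intro j; assert (Hd := dweight_pos p q j H Hp).
    rewrite Rabs_mult, (Rabs_pos_eq (dweight p q j)) by assumption.
    apply Rmult_le_compat_l; [assumption|].
    apply mlAlt_scaled_bounded; lra.
  - apply ex_series_scal_r, ex_series_dweight; assumption.
Qed.

Lemma qratio_pos (p q : R) : 0 < q < p -> p < 1 ->
  0 < qPochhammer (/ p * q) q / qPochhammer q q.
Proof.
  intros H Hp; assert (Hpq1 := inv_mul_bounds p q H).
  apply Rdiv_lt_0_compat; apply qPochhammer_pos; lra.
Qed.

Lemma mlAlt_grid_equation (p q x : R) (n : nat) : 0 < q < p -> p < 1 -> 0 <= x < 1 ->
  (1 + x * p ^ n) * mlAlt p q (x * p ^ n)
  = qPochhammer (/ p * q) q / qPochhammer q q
    + Series (fun j => dweight p q j * mlAlt p q (x * p ^ (n + S j))).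
Proof.
  intros H Hp Hx.
  rewrite mlAlt_differential_equation
    by (try assumption; apply mul_pow_lt_1; lra).
  f_equal; apply Series_ext; intro j; rewrite pow_add; do 2 f_equal; ring.
Qed.

Lemma mlAlt_ge_0 (p q x : R) : 0 < q < p -> p < 1 -> 0 <= x < 1 -> 0 <= mlAlt p q x.
Proof.
  intros H Hp Hx.
  replace x with (x * p ^ 0) by (simpl; ring).
  apply minimum_principle
    with (e := dweight p q) (v := fun n => mlAlt p q (x * p ^ n))
         (lam := fun n => 1 + x * p ^ n)
         (M := Series (fun k => / qPochhammer q q * x ^ k)) (n := 0%nat).
  - intro j; apply dweight_pos; assumption.
  - apply ex_series_dweight; assumption.
  - rewrite Series_dweight by assumption; assert (K := qratio_pos p q H Hp); lra.
  - intro n; assert (0 <= x * p ^ n < 1) by (apply mul_pow_lt_1; lra); lra.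
  - intro n; apply mlAlt_scaled_bounded; lra.
  - intro n; rewrite mlAlt_grid_equation by assumption.
    assert (K := qratio_pos p q H Hp); lra.
Qed.

(** Subtracting consecutive grid equations, the increments of [mlAlt] satisfy the
    same system with the nonnegative source
    x (p^n - p^(n+1)) mlAlt (x p^(n+1)) in place of the constant. *)
Lemma mlAlt_le_scaled_1 (p q x : R) : 0 < q < p -> p < 1 -> 0 <= x < 1 ->
  mlAlt p q x <= mlAlt p q (x * p).
Proof.
  intros H Hp Hx.
  set (M := Series (fun k => / qPochhammer q q * x ^ k)).
  enough (Hn : forall n, 0 <= mlAlt p q (x * p ^ S n) - mlAlt p q (x * p ^ n)).
  { specialize (Hn 0%nat); simpl in Hn; rewrite !Rmult_1_r in Hn; lra. }
  apply minimum_principle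
    with (e := dweight p q) (lam := fun n => 1 + x * p ^ n) (M := M + M)
         (v := fun n => mlAlt p q (x * p ^ S n) - mlAlt p q (x * p ^ n)).
  - intro j; apply dweight_pos; assumption.
  - apply ex_series_dweight; assumption.
  - rewrite Series_dweight by assumption; assert (K := qratio_pos p q H Hp); lra.
  - intro n; assert (0 <= x * p ^ n < 1) by (apply mul_pow_lt_1; lra); lra.
  - intro n; eapply Rle_trans; [apply Rabs_triang|].
    rewrite Rabs_Ropp; apply Rplus_le_compat; apply mlAlt_scaled_bounded; lra.
  - intro n.
    assert (E0 := mlAlt_grid_equation p q x n H Hp Hx).
    assert (E1 := mlAlt_grid_equation p q x (S n) H Hp Hx).
    rewrite (Series_ext _ (fun j => dweight p q j * mlAlt p q (x * p ^ (S n + S j))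
      - dweight p q j * mlAlt p q (x * p ^ (n + S j)))) by (intro j; simpl; ring).
    rewrite Series_minus by (apply ex_series_dweight_mlAlt; assumption).
    assert (Hxn : 0 <= x * p ^ S n < 1) by (apply mul_pow_lt_1; lra).
    assert (Hpos := mlAlt_ge_0 p q (x * p ^ S n) H Hp Hxn).
    assert (Hdec : x * p ^ S n <= x * p ^ n).
    { assert (0 < p ^ n) by (apply pow_lt; lra).
      assert (0 <= x * p ^ n) by nra; simpl; nra. }
    nra.
Qed.

Lemma mlAlt_le_scaled (p q x : R) (j : nat) : 0 < q < p -> p < 1 -> 0 <= x < 1 ->
  mlAlt p q x <= mlAlt p q (x * p ^ j).
Proof.
  intros H Hp Hx; induction j as [|j IH].
  - simpl; rewrite Rmult_1_r; lra.
  - eapply Rle_trans; [exact IH|].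
    replace (x * p ^ S j) with (x * p ^ j * p) by (simpl; ring).
    apply mlAlt_le_scaled_1; try assumption; apply mul_pow_lt_1; lra.
Qed.

(** * The two bounds *)

(** Replace every grid value by the smallest one, [mlAlt p q x], in the
    differential equation. *)
Lemma mlAlt_lower_bound (p q x : R) : 0 < q < p -> p < 1 -> 0 <= x < 1 ->
  1 / (1 + x * (qPochhammer q q / qPochhammer (/ p * q) q)) <= mlAlt p q x.
Proof.
  intros H Hp Hx.
  assert (E := mlAlt_differential_equation p q x H Hp Hx).
  assert (Hle : Series (dweight p q) * mlAlt p q x
                <= Series (fun j => dweight p q j * mlAlt p q (x * p ^ S j))).
  { rewrite <- Series_scal_r; apply Series_le_signed.
    - apply ex_series_scal_r, ex_series_dweight; assumption.
    - exact (ex_series_dweight_mlAlt p q x 0 H Hp Hx).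
    - intro j; apply Rmult_le_compat_l;
        [apply dweight_pos|apply mlAlt_le_scaled]; assumption. }
  rewrite Series_dweight in Hle by assumption.
  assert (Hpq1 := inv_mul_bounds p q H).
  assert (P1 : 0 < qPochhammer q q) by (apply qPochhammer_pos; lra).
  assert (P2 : 0 < qPochhammer (/ p * q) q) by (apply qPochhammer_pos; lra).
  assert (K := qratio_pos p q H Hp).
  replace (qPochhammer q q / qPochhammer (/ p * q) q)
    with (/ (qPochhammer (/ p * q) q / qPochhammer q q)) by (field; lra).
  set (k := qPochhammer (/ p * q) q / qPochhammer q q) in *.
  replace (1 / (1 + x * / k)) with (k / (k + x)) by (field; lra).
  apply Rle_div_l; [lra|]; nra.
Qed.

(** Replace every grid value by the smallest one in the integral equation. *)
Lemma mlAlt_upper_bound (p q x : R) : 0 < q < p -> p < 1 -> 0 <= x < 1 ->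
  mlAlt p q x <= 1 / (1 + x * (qPochhammer (p * q) q / qPochhammer q q)).
Proof.
  intros H Hp Hx.
  assert (Hq : 0 < q < 1) by lra; assert (Hp' : 0 < p < 1) by lra.
  assert (Hpq : 0 <= p * q < 1) by (split; nra).
  assert (Hne : forall j, p * q ^ j <> 1)
    by (intros j Hj; destruct (pow_le_1 q j Hq); nra).
  assert (Hb : forall j, 0 <= qbin p q j).
  { induction j as [|j IH]; cbn [qbin]; [lra|].
    assert (Hs := pow_S_lt_1 q j Hq); destruct (pow_le_1 q j Hq).
    apply Rmult_le_pos; [exact IH|]; apply Rdiv_le_0_compat; nra. }
  assert (E := mlAlt_integral_equation p q x Hq Hp' Hx).
  assert (Habs := ex_series_Rabs_qbin p q q Hq Hne ltac:(lra)).
  assert (Hle : PSeries (qbin p q) q * mlAlt p q x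
    <= Series (fun j => qbin p q j * q ^ j * mlAlt p q (x * p ^ j))).
  { unfold PSeries; rewrite <- Series_scal_r; apply Series_le_signed.
    - apply ex_series_scal_r, ex_series_Rabs, Habs.
    - apply ex_series_dominated with (fun j => Rabs (qbin p q j * q ^ j)
        * Series (fun k => / qPochhammer q q * x ^ k)).
      + intro j; rewrite Rabs_mult; apply Rmult_le_compat_l; [apply Rabs_pos|].
        apply mlAlt_scaled_bounded; assumption.
      + apply ex_series_scal_r, Habs.
    - intro j; apply Rmult_le_compat_l; [|apply mlAlt_le_scaled; assumption].
      apply Rmult_le_pos; [apply Hb|apply pow_le; lra]. }
  assert (P1 : 0 < qPochhammer q q) by (apply qPochhammer_pos; lra).
  assert (P2 : 0 < qPochhammer (p * q) q) by (apply qPochhammer_pos; lra).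
  assert (B := q_binomial p q q Hq Hne ltac:(lra) Hpq).
  assert (K : 0 < qPochhammer (p * q) q / qPochhammer q q)
    by (apply Rdiv_lt_0_compat; assumption).
  replace (PSeries (qbin p q) q) with (qPochhammer (p * q) q / qPochhammer q q)
    in Hle by (rewrite <- B; field; lra).
  set (k := qPochhammer (p * q) q / qPochhammer q q) in *.
  apply Rle_div_r; [nra|].
  assert (x * (k * mlAlt p q x) <= 1 - mlAlt p q x)
    by (rewrite <- E; apply Rmult_le_compat_l; lra).
  lra.
Qed.

Lemma qMittagLeffler_mlAlt (q alpha z : R) : 0 < q < 1 -> 0 < alpha ->
  qMittagLeffler alpha 1 (- z) q
  = mlAlt (Rpower q alpha) q (z * Rpower (1 - q) alpha).
Proof.
  intros Hq Ha; apply Series_ext; intro k; unfold qGamma, mlCoef.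
  assert (Hpk : forall y, 0 < y -> Rpower y (alpha * INR k) = Rpower y alpha ^ k)
    by (intros; rewrite <- Rpower_mult, Rpower_pow by apply exp_pos; reflexivity).
  assert (Hp : 0 < Rpower q alpha < 1).
  { split; [apply exp_pos|].
    rewrite <- (Rpower_O q) by lra; unfold Rpower; apply exp_increasing.
    assert (ln q < 0) by (rewrite <- ln_1; apply ln_increasing; lra); nra. }
  rewrite Rpower_plus, Rpower_1, Hpk by lra.
  rewrite (Rmult_comm _ q).
  replace (1 - (alpha * INR k + 1)) with (- (alpha * INR k)) by ring.
  rewrite Rpower_Ropp, Hpk by lra.
  replace (- (z * Rpower (1 - q) alpha)) with (- z * Rpower (1 - q) alpha) by ring.
  rewrite Rpow_mult_distr.
  assert (0 < Rpower (1 - q) alpha ^ k) by (apply pow_lt, exp_pos).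
  assert (0 < qPochhammer q q) by (apply qPochhammer_pos; lra).
  assert (0 < qPochhammer (q * Rpower q alpha ^ k) q)
    by (apply qPochhammer_pos; [|apply mul_pow_lt_1]; lra).
  field; repeat split; lra.
Qed.

Theorem lemma3p1 (q alpha z : R)
    (hq : 0 < q < 1) (halpha : 0 < alpha < 1) (hz : 0 < z)
    (hdom : z * Rpower (1 - q) alpha < 1) :
  (1 / (1 + qGamma q (1 - alpha) * z) <= qMittagLeffler alpha 1 (- z) q
     <= 1 / (1 + / qGamma q (alpha + 1) * z)) /\
  0 < qMittagLeffler alpha 1 (- z) q < 1.
Proof.
  rewrite qMittagLeffler_mlAlt by lra.
  set (p := Rpower q alpha); set (w := z * Rpower (1 - q) alpha) in *.
  assert (Hln : ln q < 0) by (rewrite <- ln_1; apply ln_increasing; lra).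
  assert (Hp1 : p < 1).
  { rewrite <- (Rpower_O q) by lra; unfold p, Rpower; apply exp_increasing; nra. }
  assert (Hqp : 0 < q < p).
  { split; [lra|]; rewrite <- (Rpower_1 q) at 1 by lra.
    unfold p, Rpower; apply exp_increasing; nra. }
  assert (Hr : 0 < Rpower (1 - q) alpha) by apply exp_pos.
  assert (Hw : 0 < w) by (apply Rmult_lt_0_compat; assumption).
  assert (Hpq1 := inv_mul_bounds p q Hqp).
  assert (P1 : 0 < qPochhammer q q) by (apply qPochhammer_pos; lra).
  assert (P2 : 0 < qPochhammer (/ p * q) q) by (apply qPochhammer_pos; lra).
  assert (P3 : 0 < qPochhammer (p * q) q) by (apply qPochhammer_pos; nra).
  assert (G1 : qGamma q (1 - alpha) * z
               = w * (qPochhammer q q / qPochhammer (/ p * q) q)).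
  { unfold qGamma, w; replace (1 - (1 - alpha)) with alpha by ring.
    replace (Rpower q (1 - alpha)) with (/ p * q).
    - field; lra.
    - unfold Rminus; rewrite Rpower_plus, Rpower_1, Rpower_Ropp by lra.
      unfold p; ring. }
  assert (G2 : / qGamma q (alpha + 1) * z
               = w * (qPochhammer (p * q) q / qPochhammer q q)).
  { unfold qGamma, w; replace (1 - (alpha + 1)) with (- alpha) by ring.
    rewrite Rpower_plus, Rpower_1, Rpower_Ropp by lra; fold p.
    field; repeat split; lra. }
  rewrite G1, G2.
  assert (L := mlAlt_lower_bound p q w Hqp Hp1 ltac:(lra)).
  assert (U := mlAlt_upper_bound p q w Hqp Hp1 ltac:(lra)).
  assert (0 < w * (qPochhammer q q / qPochhammer (/ p * q) q))
    by (apply Rmult_lt_0_compat; [|apply Rdiv_lt_0_compat]; assumption).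
  assert (0 < w * (qPochhammer (p * q) q / qPochhammer q q))
    by (apply Rmult_lt_0_compat; [|apply Rdiv_lt_0_compat]; assumption).
  repeat split; try assumption.
  - eapply Rlt_le_trans; [|exact L]; apply Rdiv_lt_0_compat; lra.
  - eapply Rle_lt_trans; [exact U|]; apply Rlt_div_l; lra.
Qed.
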